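(* $C_3(2)=2$. That is, $\limsup_{t\to\infty} \frac{N_3(t,2)}{\log_2 t} = 2$, where $N_3(t,2)$ is the minimal worst-case total number of tests needed to find both defective elements among $t$ samples by an algorithm using at most $3$ stages.
   Context: Group testing model: there are $t$ samples, indexed by $[t]=\{1,\dots,t\}$, among which an unknown set $S_{un}$ of exactly $s$ samples is defective. A test is performed on a chosen subset $T\subseteq[t]$; its outcome is positive (1) if $T\cap S_{un}\neq\emptyset$ and negative (0) otherwise; outcomes are always correct (noiseless). A $p$-stage algorithm is divided into $p$ stages; the tests of stage $i$ are all chosen before any test of stage $i$ is performed, and may depend on the outcomes of all tests from stages $1,\dots,i-1$. The algorithm must determine $S_{un}$ exactly for every possible $S_{un}$ with $|S_{un}|=s$. $N_p(t,s)$ denotes the minimal, over all $p$-stage algorithms, worst-case (over $S_{un}$) total number of tests, and $C_p(s)=\limsup_{t\to\infty} N_p(t,s)/\log_2 t$. *)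

(* Defs.v *)
From mathcomp Require Import all_boot all_order all_algebra.
From mathcomp Require Import all_classical all_reals all_analysis.
Set Implicit Arguments. Unset Strict Implicit. Unset Printing Implicit Defensive.
Import Order.TTheory GRing.Theory Num.Theory.

(* Samples are 'I_t.  A (deterministic, adaptive-by-stages) group testing
   algorithm on t samples: at stage k (k = 0, 1, ...), given the outcomes of
   all tests of the previous stages (concatenated, in order), it outputs the
   list of tests (subsets of samples) of stage k, all chosen before any of
   them is performed.  (The concatenated history is uniquely decodable into
   stages, since the number of tests of each stage is determined by the
   history before it.) *)
Definition gt_alg (t : nat) := nat -> seq bool -> seq {set 'I_t}.

Definition outcome (t : nat) (S T : {set 'I_t}) : bool := T :&: S != finset.set0.

Fixpoint run (t : nat) (A : gt_alg t) (S : {set 'I_t}) (k : nat) : seq bool :=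
  match k with
  | 0 => [::]
  | k'.+1 => let h := run A S k' in h ++ [seq outcome S T | T <- A k' h]
  end.

(* There is a p-stage algorithm that determines every defective set of size
   exactly s, using at most n tests in the worst case.  The total number of
   tests performed on S is the length of the outcome history. *)
Definition feasible (p t s n : nat) : Prop :=
  exists (A : gt_alg t) (dec : seq bool -> {set 'I_t}),
    forall S : {set 'I_t}, #|S| = s ->
      dec (run A S p) = S /\ (size (run A S p) <= n)%N.

Lemma feasible_ex_bool (p t s : nat) :
  (exists n, feasible p t s n) -> exists n, `[< feasible p t s n >].
Proof. by case=> n h; exists n; apply/asboolP. Qed.

(* N_p(t,s): minimal worst-case number of tests over all p-stage algorithms.
   (Default value 0 when no p-stage algorithm exists at all, which can only
   happen for p = 0; irrelevant for p >= 1.) *)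
Definition N (p t s : nat) : nat :=
  match pselect (exists n, feasible p t s n) with
  | left h => ex_minn (feasible_ex_bool h)
  | right _ => 0
  end.

Definition C {R : realType} (p s : nat) : \bar R :=
  limn_esup (fun t : nat =>
    (((N p t s)%:R : R) / (ln (t%:R : R) / ln (2 : R)))%:E).

(* Main.v *)
Require Import Defs.
From mathcomp Require Import all_boot all_order all_algebra.
From mathcomp Require Import all_classical all_reals all_analysis.
From mathcomp Require Import zify ring lra.
Set Implicit Arguments. Unset Strict Implicit. Unset Printing Implicit Defensive.
Import Order.TTheory GRing.Theory Num.Theory numFieldNormedType.Exports.

(** Lower bound: the outcome history determines the defective pair, so
    [t (t - 1) / 2 <= 2 ^ (n + 1)].

    Upper bound, already with two stages.  Give the samples independent uniform
    binary words of length [n], about [(2 + 2/k) log2 t], and of a fixed weight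
    [w]; test [j] of stage 1 pools the samples whose word has bit [j], so its
    outcome vector is the bitwise or [V] of the two defective words.  For Bernoulli words
    with [q = P(bit = 0)], [q ^ 2 = 1 / 2], the or of two words is uniform.  By
    pigeonhole some weight class has mass at least [1 / (n + 1)]; conditioning on
    it costs polynomial factors only: a pair of words has or [V] with
    probability at most [(n + 1) ^ 2 / 2 ^ n], and a given word is completed to
    [V] by a random word of the same weight with probability at most
    [(n + 1) / 2 ^ (n / 2)], because [2 (1 - q) <= q].
    Consider sequences of pairs with or [V] such that each pair contains a sample
    absent from the earlier ones.  Each further pair multiplies the expected
    number of such sequences by [t ^ (- 1 / k)] up to polylogarithmic factors,
    so for some code no sequence of length [4 (k + 1)] exists, for any [V].
    The samples of a maximal sequence then contain every candidate pair, and
    stage 2 tests these boundedly many samples one by one. *)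

(** * Counting codes along chains of pairs *)

Definition upd (I Om : finType) (f : {ffun I -> Om}) (y : I) (w : Om) :
  {ffun I -> Om} := [ffun i => if i == y then w else f i].

(** Exchanging the value at [y] with an extra letter [w] is an involution on pairs (code,
    letter). *)
Lemma sum_resample (I Om : finType) (F : {ffun I -> Om} -> nat) (y : I) :
  #|Om| * \sum_f F f = \sum_f \sum_w F (upd f y w).
Proof.
rewrite pair_bigA /=.
pose sw (g : {ffun I -> Om} * Om) := (upd g.1 y g.2, g.1 y).
have swK : involutive sw.
  move=> [f w]; rewrite /sw /=; congr pair; last by rewrite ffunE eqxx.
  by apply/ffunP => i; rewrite !ffunE; case: eqP => // ->.
rewrite [RHS](reindex_inj (inv_inj swK)) /=.
under [RHS]eq_bigr => g _.
  rewrite (_ : upd (upd g.1 y g.2) y (g.1 y) = g.1); last first.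
    by apply/ffunP => i; rewrite !ffunE; case: eqP => // ->.
  over.
rewrite -(pair_bigA _ (fun f _ => F f)) /=.
rewrite big_distrr; apply: eq_bigr => f _; by rewrite sum_nat_const.
Qed.

Definition supp (I : finType) (c : seq (I * I)) : seq I :=
  [seq e.1 | e <- c] ++ [seq e.2 | e <- c].

Definition monochrome (I Om : finType) (Om' : eqType) (u : Om -> Om -> Om') (V : Om')
    (f : I -> Om) (c : seq (I * I)) : bool :=
  all (fun e => u (f e.1) (f e.2) == V) c.

(** Pairs are directed: [e.2] is a fresh sample, [e.1] may be old or fresh. *)
Definition grows (I : finType) (c : seq (I * I)) (e : I * I) : bool :=
  (e.1 != e.2) && (e.2 \notin supp c).

Fixpoint chains (I : finType) (L : nat) : seq (seq (I * I)) :=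
  if L is L'.+1 then
    [seq e :: c | c <- chains I L', e <- [seq e <- enum {: I * I} | grows c e]]
  else [:: [::]].

Lemma size_chains (I : finType) L (c : seq (I * I)) : c \in chains I L -> size c = L.
Proof.
elim: L c => [|L IHL] c /=; first by rewrite inE => /eqP ->.
by case/allpairsPdep => [c' [e [/IHL <- _ ->]]].
Qed.

Lemma monochrome_upd (I Om : finType) (Om' : eqType) (u : Om -> Om -> Om') V
    (f : {ffun I -> Om}) (c : seq (I * I)) (y : I) (w : Om) :
  y \notin supp c -> monochrome u V (upd f y w) c = monochrome u V f c.
Proof.
rewrite mem_cat negb_or => /andP[y1 y2]; apply: eq_in_all => e ec.
by rewrite !ffunE !ifN //; [apply: contraNneq y2 | apply: contraNneq y1] => <-; apply: map_f.
Qed.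

(** The probability over uniform codes, left unnormalised: a factor [#|Om| ^ #|I|] keeps it in
    [nat]. *)
Definition nb_mono (I Om : finType) (Om' : eqType) (u : Om -> Om -> Om') (V : Om')
    (c : seq (I * I)) : nat :=
  \sum_(f : {ffun I -> Om}) monochrome u V f c.

(** Resampling the fresh [e.2] does not affect [c], so only the number of letters completing [f e.1]
    to [V] enters. *)
Lemma nb_mono_step (I Om : finType) (Om' : eqType) (u : Om -> Om -> Om') (V : Om')
    (c : seq (I * I)) (e : I * I) : grows c e ->
  #|Om| * nb_mono u V (e :: c) =
  \sum_(f : {ffun I -> Om}) monochrome u V f c * #|[pred w | u (f e.1) w == V]|.
Proof.
case: e => x y /andP[/= xy yc]; rewrite /nb_mono (sum_resample _ y).
apply: eq_bigr => f _; rewrite -sum1_card big_distrr /= [RHS]big_mkcond /=.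
apply: eq_bigr => w _; rewrite (monochrome_upd _ _ _ _ yc) !ffunE eqxx (negPf xy).
by rewrite inE; case: (_ == V) => //=; rewrite muln1.
Qed.

Lemma nb_mono_old (I Om : finType) (Om' : eqType) (u : Om -> Om -> Om') (V : Om')
    (S : nat) (c : seq (I * I)) e : (forall x, #|[pred w | u x w == V]| <= S) -> grows c e ->
  #|Om| * nb_mono u V (e :: c) <= S * nb_mono u V c.
Proof.
move=> hS ge; rewrite (nb_mono_step _ _ ge) [S * _]mulnC /nb_mono big_distrl /=.
by apply: leq_sum => f _; rewrite leq_mul2l hS orbT.
Qed.

(** With both ends fresh, resampling [e.1] as well replaces the worst completion count by the sum
    over all letters. *)
Lemma nb_mono_new (I Om : finType) (Om' : eqType) (u : Om -> Om -> Om') (V : Om')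
    (P : nat) (c : seq (I * I)) e : \sum_x #|[pred w | u x w == V]| <= P -> grows c e ->
  e.1 \notin supp c ->
  #|Om| ^ 2 * nb_mono u V (e :: c) <= P * nb_mono u V c.
Proof.
move=> hP ge xc; rewrite expnS expn1 -mulnA (nb_mono_step _ _ ge) (sum_resample _ e.1).
rewrite [P * _]mulnC /nb_mono big_distrl /=; apply: leq_sum => f _.
under eq_bigr => w _ do rewrite (monochrome_upd _ _ _ _ xc) ffunE eqxx.
by rewrite -big_distrr leq_mul2l hP orbT.
Qed.

(** A chain extends by at most [#|I| ^ 2] pairs with both ends fresh and at most [2 * K * #|I|]
    pairs with an old first end. The uniform bound [K] on lengths makes the factor the same at every
    induction step. *)
Lemma sum_chains (I Om : finType) (Om' : eqType) (u : Om -> Om -> Om') (V : Om')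
    (P S K L : nat) :
  \sum_x #|[pred w | u x w == V]| <= P ->
  (forall x, #|[pred w | u x w == V]| <= S) -> L <= K ->
  #|Om| ^ (2 * L) * \sum_(c <- chains I L) nb_mono u V c <=
  #|Om| ^ #|I| * (#|I| ^ 2 * P + 2 * K * #|I| * (#|Om| * S)) ^ L.
Proof.
move=> hP hS; set B := _ + 2 * K * _ * _; elim: L => [|L IHL] LK.
  rewrite /= big_seq1 !expn0 mul1n muln1 /nb_mono; under eq_bigr do rewrite /=.
  by rewrite sum_nat_const muln1 card_ffun.
rewrite /= big_allpairs_dep /= mulnS expnD [B ^ _]expnSr !mulnA.
rewrite -[X in X <= _]mulnA [X in X <= _]mulnCA.
apply: leq_trans (leq_mul (IHL (ltnW LK)) (leqnn B)).
rewrite -mulnA leq_mul2l; apply/orP; right.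
rewrite big_distrr big_distrl /= big_seq [X in _ <= X]big_seq.
apply: leq_sum => c /size_chains sc.
rewrite big_filter big_distrr /= big_enum_cond /=.
rewrite (bigID (fun e : I * I => e.1 \in supp c)) /= addnC mulnDr.
apply: leq_add.
  apply: (@leq_trans (\sum_(e : I * I) P * nb_mono u V c)).
    rewrite big_mkcond; apply: leq_sum => e _.
    by case: ifP => // /andP[ge xc]; apply: nb_mono_new.
  by rewrite sum_nat_const card_prod [P * _]mulnC mulnCA mulnn.
apply: (@leq_trans (\sum_(x in supp c) \sum_(y : I) #|Om| * S * nb_mono u V c)).
  rewrite pair_big /= big_mkcond [X in _ <= X]big_mkcond; apply: leq_sum => e _ /=.
  rewrite andbT; case: ifP => // /andP[ge ->].
  by rewrite expnS expn1 -!mulnA leq_mul2l (nb_mono_old hS ge) orbT.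
rewrite sum_nat_const sum_nat_const.
have hc : #|supp c| <= 2 * K.
  by apply: leq_trans (card_size _) _; rewrite /supp size_cat !size_map sc; lia.
have -> : nb_mono u V c * (2 * K * #|I| * (#|Om| * S)) =
    2 * K * (#|I| * (#|Om| * S * nb_mono u V c)).
  by rewrite mulnC !mulnA.
exact: leq_mul.
Qed.

(** First moment: if every code had a monochrome chain for some [V], the count summed over [V] and
    chains would be at least the number of codes. The factor [#|Om'|] is the union bound over
    [V]. *)
Lemma exists_chainless (I Om Om' : finType) (u : Om -> Om -> Om') (P S L : nat) :
  0 < #|Om| ->
  (forall V, \sum_x #|[pred w | u x w == V]| <= P) ->
  (forall V x, #|[pred w | u x w == V]| <= S) ->
  #|Om'| * (#|I| ^ 2 * P + 2 * L * #|I| * (#|Om| * S)) ^ L < #|Om| ^ (2 * L) ->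
  exists f : {ffun I -> Om}, forall V c, c \in chains I L -> ~~ monochrome u V f c.
Proof.
move=> M0 hP hS hB.
case: (boolP [exists f : {ffun I -> Om}, [forall V, ~~ has (monochrome u V f) (chains I L)]]).
  by case/existsP => f /forallP fV; exists f => V c cL; move/hasPn: (fV V); apply.
move=> /existsPn all_bad; exfalso; move: hB; apply/negP; rewrite -leqNgt.
rewrite -(@leq_pmul2l (#|Om| ^ #|I|)) ?expn_gt0 ?M0 // mulnCA.
apply: (@leq_trans (\sum_(V : Om') #|Om| ^ (2 * L) *
   \sum_(c <- chains I L) \sum_(f : {ffun I -> Om}) monochrome u V f c)); last first.
  by rewrite -sum_nat_const; apply: leq_sum => V _; apply: sum_chains.
rewrite -big_distrr mulnC /= leq_mul2l; apply/orP; right.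
under eq_bigr do rewrite exchange_big.
rewrite exchange_big -card_ffun -sum1_card; apply: leq_sum => f _ /=.
have /forallPn[V] := all_bad f; rewrite negbK => /hasP[c cL cV].
by rewrite (bigD1 V) //= (big_rem c cL) /= cV -addnA.
Qed.

(** Induction on [L] reaches a chain that cannot be extended. Its support contains the second end of
    every candidate pair, hence by symmetry of [u] also the first. *)
Lemma cover_of_chainless (I Om Om' : finType) (u : Om -> Om -> Om') (f : I -> Om) V L :
  (forall x y, u x y = u y x) ->
  (forall c, c \in chains I L -> ~~ monochrome u V f c) ->
  exists U : {set I}, #|U| <= 2 * L /\
    forall x y, x != y -> u (f x) (f y) = V -> x \in U /\ y \in U.
Proof.
move=> uC; elim: L => [|L IHL] noL; first by move: (noL [::]); rewrite inE eqxx => /(_ isT).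
case: (boolP (has (monochrome u V f) (chains I L))) => [/hasP[c cL cV]|/hasPn noL']; last first.
  by have [U [sU hU]] := IHL noL'; exists U; split => //; lia.
exists [set x in supp c]; split.
  rewrite cardsE; apply: leq_trans (card_size _) _.
  by rewrite /supp size_cat !size_map (size_chains cL); lia.
have ext x y : x != y -> u (f x) (f y) = V -> y \in supp c.
  move=> xy uV; apply: contraT => yc.
  have := noL ((x, y) :: c); rewrite /= uV eqxx cV; move=> H; apply: H.
  apply/allpairsPdep; exists c, (x, y); split => //.
  by rewrite mem_filter mem_enum /grows /= xy yc.
move=> x y xy uV; rewrite !inE; split; last exact: ext xy uV.
by apply: (ext y x); [rewrite eq_sym | rewrite uC].
Qed.

(** * Bernoulli words and their fixed-weight classes *)

Local Open Scope ring_scope.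

Definition word (n : nat) := {ffun 'I_n -> bool}.
Definition join n (x y : word n) : word n := [ffun i => x i || y i].
Definition wt n (x : word n) : nat := (\sum_i x i)%N.

Definition bern (R : comNzRingType) (p q : R) n (x : word n) : R :=
  \prod_i (if x i then p else q).

Lemma wt_lt n (x : word n) : (wt x < n.+1)%N.
Proof.
rewrite ltnS /wt -[X in (_ <= X)%N]card_ord -sum1_card.
by apply: leq_sum => i _; case: (x i).
Qed.

Lemma bernE (R : comNzRingType) (p q : R) n (x : word n) :
  bern p q x = p ^+ wt x * q ^+ (n - wt x).
Proof.
have -> : (n - wt x = \sum_i ~~ x i)%N.
  have : (\sum_i (x i + ~~ x i) = n)%N.
    rewrite -[RHS]card_ord -sum1_card; apply: eq_bigr => i _; by case: (x i).
  by rewrite big_split /= -/(wt x) => E; lia.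
rewrite -!prodrXr -big_split; apply: eq_bigr => i _ /=.
by case: (x i); rewrite ?expr1 ?expr0 ?mulr1 ?mul1r.
Qed.

Lemma sum_bern (R : comNzRingType) (p q : R) n :
  p + q = 1 -> \sum_(x : word n) bern p q x = 1.
Proof.
move=> pq; rewrite -(bigA_distr_bigA (fun _ (b : bool) => if b then p else q)).
by rewrite big1 // => i _; rewrite big_bool.
Qed.

Lemma natr_forall n (P : pred 'I_n) (R : comNzRingType) :
  ([forall i, P i]%:R = \prod_i (P i)%:R :> R).
Proof.
case: (boolP [forall i, P i]) => [/forallP h|/forallPn[i h]].
  by rewrite big1 // => i _; rewrite h.
by rewrite (bigD1 i) //= (negPf h) mul0r.
Qed.

Lemma join_eqE n (x y V : word n) : (join x y == V) = [forall i, (x i || y i) == V i].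
Proof.
apply/eqP/forallP => [<- i|h]; first by rewrite ffunE.
by apply/ffunP => i; rewrite ffunE; apply/eqP.
Qed.

(** The bits of the join are independent, and each is 0 with probability [q ^ 2 = 1 / 2]. *)
Lemma bern_join (R : comNzRingType) (p q : R) n (V : word n) :
  p + q = 1 -> q ^+ 2 *+ 2 = 1 ->
  (\sum_(x : word n) \sum_(y : word n) bern p q x * bern p q y * (join x y == V)%:R)
    * 2 ^+ n = 1.
Proof.
move=> pq q2; pose m (b : bool) := if b then p else q.
transitivity ((\prod_(i < n) \sum_(a : bool) \sum_(b : bool)
    m a * m b * ((a || b) == V i)%:R) * 2 ^+ n).
  congr (_ * _); rewrite bigA_distr_bigA; apply: eq_bigr => x _.
  rewrite bigA_distr_bigA; apply: eq_bigr => y _.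
  by rewrite join_eqE natr_forall /bern -!big_split.
rewrite -[n in 2 ^+ n]card_ord -prodr_const -big_split big1 //= => i _.
rewrite !big_bool /m /=; case: (V i) => /=; have pE : p = 1 - q by rewrite -pq addrK.
  have h : 1 - q ^+ 2 *+ 2 = 0 by rewrite q2 subrr.
  by apply/eqP; rewrite -subr_eq0 -[X in _ == X]h pE; apply/eqP; ring.
by rewrite -[RHS]q2; ring.
Qed.

(** The summand carries the mass of [x], which is that of [y] when both words
    have the same weight. *)
Lemma bern_star (R : realFieldType) (p q : R) n (x V : word n) :
  0 <= p -> 0 <= q -> p *+ 2 <= q ->
  \sum_(y : word n) bern p q x * (join x y == V)%:R <= q ^+ n.
Proof.
move=> p0 q0 pq.
under eq_bigr do rewrite join_eqE natr_forall -big_split /=.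
rewrite -(bigA_distr_bigA (fun i b => (if x i then p else q) * ((x i || b) == V i)%:R)).
rewrite -[n in q ^+ n]card_ord -prodr_const; apply: ler_prod => i _.
(* Both bits of [y] are allowed only where [x i] and [V i] hold, giving [p *+ 2 <= q]; elsewhere the
   factor is 0 or [q]. *)
by rewrite big_bool; case: (x i); case: (V i) => /=; apply/andP; split; lra.
Qed.

Lemma exists_weight (R : realFieldType) (p q : R) n : p + q = 1 ->
  exists w : 'I_n.+1,
    1 <= n.+1%:R * (#|[pred x : word n | wt x == w]|%:R * (p ^+ w * q ^+ (n - w))).
Proof.
move=> pq; apply/existsP; apply: contraT => /existsPn h.
have : \sum_(x : word n) bern p q x < 1.
  rewrite (partition_big (fun x => Ordinal (wt_lt x)) xpredT) //=.
  apply: (@lt_le_trans _ _ (\sum_(w < n.+1) n.+1%:R^-1)); last first.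
    by rewrite sumr_const card_ord -[_ *+ _]mulr_natr mulVf ?pnatr_eq0.
  apply: ltr_sum; first by apply/hasP; exists ord0; rewrite ?mem_index_enum.
  move=> w _; move: (h w); rewrite -ltNge mulrC -ltr_pdivlMr ?ltr0n // div1r.
  apply: le_lt_trans; rewrite mulr_natl -sumr_const.
  rewrite le_eqVlt; apply/orP; left; apply/eqP; apply: eq_big => [x|x /eqP <- /=].
    by rewrite inE.
  exact: bernE.
by rewrite sum_bern ?ltxx.
Qed.

(** The even length makes [q ^ n] equal to [2 ^- h], so the bounds can be stated in [nat]; [R]
    supplies the square root [q]. *)
Lemma exists_weight_class (R : rcfType) (h : nat) :
  exists w : nat, let Om := {x : word (2 * h) | wt x == w} in
  [/\ (0 < #|{: Om}|)%N,
      forall V, ((\sum_(x : Om) #|[pred y : Om | join (val x) (val y) == V]|) * 2 ^ (2 * h)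
                   <= (2 * h).+1 ^ 2 * #|{: Om}| ^ 2)%N
    & forall V (x : Om),
        (#|[pred y : Om | join (val x) (val y) == V]| * 2 ^ h <= (2 * h).+1 * #|{: Om}|)%N].
Proof.
set n := (2 * h)%N.
pose q : R := Num.sqrt 2^-1; pose p : R := 1 - q.
have q2 : q ^+ 2 = 2^-1 by rewrite sqr_sqrtr // invr_ge0.
have q0 : 0 <= q by apply: sqrtr_ge0.
have q1 : q <= 1 by rewrite -(ler_pXn2r (n := 2)) ?nnegrE // q2; lra.
(* Equivalent to [p *+ 2 <= q], as [bern_star] requires. *)
have q23 : 2 <= 3 * q by rewrite -(ler_pXn2r (n := 2)) ?nnegrE //; [rewrite exprMn q2; lra | lra].
have p0 : 0 < p by rewrite subr_gt0 -(ltr_pXn2r (n := 2)) ?nnegrE // q2; lra.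
have pq : p + q = 1 by rewrite subrK.
have [[w /= _] ] := exists_weight n pq.
set b := p ^+ w * q ^+ (n - w) => hw.
exists w; set Om := sig _.
have cardOm : #|{: Om}| = #|[pred x : word n | wt x == w]| by rewrite card_sig.
rewrite -cardOm in hw; set M := #|{: Om}| in hw *.
have b0 : 0 < b by rewrite mulr_gt0 ?exprn_gt0 //; lra.
have bE (x : Om) : bern p q (val x) = b by rewrite bernE (eqP (valP x)).
have bern0 (x : word n) : 0 <= bern p q x by rewrite bernE mulr_ge0 ?exprn_ge0 // ltW.
have cardE V (x : Om) : #|[pred y : Om | join (val x) (val y) == V]|%:R =
    \sum_(y : Om) (join (val x) (val y) == V)%:R :> R.
  by rewrite -sum1_card natr_sum big_mkcond; apply: eq_bigr => y _; rewrite inE; case: eqP.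
have sub_sum (F : word n -> R) : (forall x, 0 <= F x) -> \sum_(x : Om) F (val x) <= \sum_x F x.
  move=> F0; rewrite -(big_sub [pred x : word n | wt x == w]) big_mkcond.
  by apply: ler_sum => x _; case: ifP.
split.
- rewrite lt0n; apply: contraTN isT => /eqP M0; move: hw.
  by rewrite M0 mul0r mulr0 ler10.
- move=> V; rewrite -(ler_nat R) !natrM !natrX natr_sum.
  (* Every word of the class has mass [b], so counts times [b * b] are Bernoulli masses; summing
     over all words instead only enlarges them. *)
  rewrite -(ler_pM2r (mulr_gt0 b0 b0)).
  apply: (@le_trans _ _ 1); last first.
    rewrite -expr2 -!exprMn -mulrA -[X in X <= _](expr1n _ 2).
    by rewrite ler_pXn2r // nnegrE ?ler01 // (le_trans ler01).
  rewrite -[X in _ <= X](bern_join V pq _); last by rewrite q2; lra.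
  rewrite mulrAC ler_wpM2r ?exprn_ge0 // big_distrl /=.
  apply: le_trans (sub_sum (fun x => \sum_(y : word n)
    bern p q x * bern p q y * (join x y == V)%:R) _).
    apply: ler_sum => x _; rewrite cardE big_distrl /=.
    apply: le_trans (sub_sum (fun y =>
      bern p q (val x) * bern p q y * (join (val x) y == V)%:R) _).
      by apply: ler_sum => y _; rewrite !bE mulrC.
    by move=> y; rewrite !mulr_ge0.
  by move=> x; apply: sumr_ge0 => y _; rewrite !mulr_ge0.
- move=> V x; rewrite -(ler_nat R) !natrM natrX.
  rewrite -(ler_pM2r b0) -[X in _ <= X]mulrA.
  apply: le_trans hw; rewrite mulrAC.
  have q2n : q ^+ n * 2 ^+ h = 1.
    by rewrite /n exprM q2 -exprMn mulVf ?pnatr_eq0 // expr1n.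
  rewrite -[X in _ <= X]q2n.
  rewrite ler_wpM2r ?exprn_ge0 // cardE.
  apply: le_trans (@bern_star _ p q n (val x) V (ltW p0) q0 _); last first.
    rewrite /p; lra.
  rewrite -(bE x) mulrC big_distrr /=.
  by apply: (sub_sum (fun y => bern p q (val x) * (join (val x) y == V)%:R)) => y; rewrite mulr_ge0.
Qed.

(** * Choice of the parameters *)

(** Since [t * 2 ^ a <= 2 ^ h], each pair of a chain contributes a factor at most [K / 2 ^ a], with
    [K] polynomial in [h]. The [2 ^ n = (2 ^ a) ^ (L / 2)] values of [V] are then beaten by [L]
    pairs as soon as [K ^ 2 < 2 ^ a]. *)
Lemma exists_good_code (R : rcfType) (t k a : nat) :
  let h := (k.+1 * a)%N in let L := (4 * k.+1)%N in
  (t <= 2 ^ (k * a))%N -> (((2 * L).+1 * (2 * h).+1) ^ 2 < 2 ^ a)%N ->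
  exists f : 'I_t -> word (2 * h), forall V, exists U : {set 'I_t}, (#|U| <= 2 * L)%N /\
    forall x y, x != y -> join (f x) (f y) = V -> x \in U /\ y \in U.
Proof.
move=> h L; set n := (2 * h)%N; set K := (_ * n.+1)%N => tk Ka.
have [w /= [M0 hP hS]] := exists_weight_class R h; rewrite -/n in M0 hP hS.
set M := #|_| in M0 hP hS.
pose u (x y : {x : word n | wt x == w}) := join (val x) (val y).
pose P := (n.+1 ^ 2 * M ^ 2 %/ 2 ^ n)%N; pose S := (n.+1 * M %/ 2 ^ h)%N.
have hP' V : (\sum_x #|[pred y | u x y == V]| <= P)%N by rewrite leq_divRL ?expn_gt0 ?hP.
have hS' V x : (#|[pred y | u x y == V]| <= S)%N by rewrite leq_divRL ?expn_gt0 ?hS.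
have hB : (#|{: word n}| * (#|'I_t| ^ 2 * P + 2 * L * #|'I_t| * (M * S)) ^ L < M ^ (2 * L))%N.
  rewrite card_ffun card_bool !card_ord; set B := (_ + _)%N.
  pose A := (2 ^ a)%N; pose H := (2 ^ h)%N.
  have PH : (P * (H * H) <= n.+1 ^ 2 * M ^ 2)%N.
    by rewrite -expnD addnn -mul2n leq_divM.
  have SH : (S * H <= n.+1 * M)%N by apply: leq_divM.
  have tA : (t * A <= H)%N by rewrite /H /h mulSn addnC expnD leq_mul2r tk orbT.
  have nA : (n.+1 <= A)%N.
    apply: ltnW; apply: leq_ltn_trans Ka; rewrite expnS expn1.
    by apply: (@leq_trans K); [apply: leq_pmull | apply: leq_pmulr; rewrite muln_gt0].
  have tn : (t * n.+1 <= H)%N by apply: leq_trans tA; rewrite leq_mul2l nA orbT.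
  have H0 : (0 < H)%N by rewrite expn_gt0.
  have A0 : (0 < A)%N by rewrite expn_gt0.
  have BH : (B * (H * H) <= M ^ 2 * (K * t) * H)%N.
    have h1 : (t ^ 2 * P * (H * H) <= M ^ 2 * (n.+1 * t) * H)%N.
      rewrite -mulnA; apply: leq_trans (leq_mul (leqnn _) PH) _.
      rewrite (_ : t ^ 2 * _ = M ^ 2 * (n.+1 * t) * (t * n.+1))%N; last by rewrite !expnS !expn0; lia.
      by rewrite leq_mul2l tn orbT.
    have h2 : (2 * L * t * (M * S) * (H * H) <= M ^ 2 * (2 * L * n.+1 * t) * H)%N.
      rewrite (_ : _ * (H * H) = 2 * L * t * M * H * (S * H))%N; last by lia.
      apply: leq_trans (leq_mul (leqnn _) SH) _.
      by rewrite expnS expn1; lia.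
    rewrite /B mulnDl; apply: leq_trans (leq_add h1 h2) _.
    by rewrite -mulnDl -mulnDr /K -mulnDl -{1}[n.+1]mul1n -mulnDl add1n.
  have BA : (B * A <= M ^ 2 * K)%N.
    rewrite -(leq_pmul2r H0) -(leq_pmul2r H0).
    rewrite (_ : B * A * H * H = B * (H * H) * A)%N; last by lia.
    apply: leq_trans (leq_mul BH (leqnn A)) _.
    rewrite (_ : _ * A = M ^ 2 * K * H * (t * A))%N; last by lia.
    by rewrite leq_mul2l tA orbT.
  pose l := (2 * k.+1)%N.
  have nE : (2 ^ n = A ^ l)%N by rewrite -expnM /n /h /l; congr expn; lia.
  have LE : (L = 2 * l)%N by rewrite /L /l; lia.
  rewrite nE -(@ltn_pmul2l (A ^ l)) ?expn_gt0 ?A0 //.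
  apply: (@leq_ltn_trans ((M ^ 2 * K) ^ L)).
    rewrite mulnA -expnD addnn -mul2n -LE -expnMn mulnC.
    by rewrite leq_exp2r // /L.
  rewrite expnMn -expnM mulnC ltn_pmul2r ?expn_gt0 ?M0 // LE expnM.
  by rewrite ltn_exp2r // /l.
have [f hf] := @exists_chainless 'I_t _ _ u P S L M0 hP' hS' hB.
exists (fun x => val (f x)) => V.
have uC x y : u x y = u y x by apply/ffunP => i; rewrite !ffunE orbC.
have [U [sU hU]] := cover_of_chainless uC (hf V).
by exists U; split.
Qed.

(** * The algorithm given by a code *)

Lemma outcome_pair (t : nat) (x y : 'I_t) (P : pred 'I_t) :
  outcome [set x; y]%SET [set z | P z]%SET = P x || P y.
Proof.
apply/set0Pn/orP => [[z]|].
  by rewrite !inE => /andP[Pz /orP[] /eqP <-]; [left | right].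
by case=> Pz; [exists x | exists y]; rewrite !inE Pz eqxx ?orbT.
Qed.

Lemma outcome_set1 (t : nat) (S : {set 'I_t}) (z : 'I_t) : outcome S [set z]%SET = (z \in S).
Proof.
apply/set0Pn/idP => [[w]|zS]; last by exists z; rewrite !inE eqxx.
by rewrite !inE => /andP[/eqP ->].
Qed.

Lemma feasible_of_code (t n m : nat) (f : 'I_t -> word n) :
  (forall V, exists U : {set 'I_t}, (#|U| <= m)%N /\
    forall x y, x != y -> join (f x) (f y) = V -> x \in U /\ y \in U) ->
  feasible 3 t 2 (n + m).
Proof.
move=> /choice[U hU].
(* Only the first [n] outcomes are read, so the decoder finds the same [V] from the full history. *)
pose V (h : seq bool) : word n := [ffun j : 'I_n => nth false h j].
pose A : gt_alg t := fun k h => match k with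
  | 0 => [seq [set x | f x j]%SET | j : 'I_n <- enum 'I_n]
  | 1 => [seq [set x]%SET | x <- enum (U (V h))]
  | _ => [::] end.
(* Stage 3 is empty; the outcomes after the first [n] are the membership mask of the defective pair
   in [U]. *)
exists A, (fun h => [set x in mask (drop n h) (enum (U (V h)))]%SET) => S.
move/eqP/cards2P => [x [y [xy ->]]].
rewrite /= cats0; set S' := [set x; y]%SET.
set h0 := map _ _; set h1 := map _ _.
have s0 : size h0 = n by rewrite /h0 size_map size_map size_enum_ord.
have Vh : V h0 = join (f x) (f y).
  apply/ffunP => j; rewrite !ffunE /h0 -map_comp.
  have sj : (j < size (enum 'I_n))%N by rewrite size_enum_ord.
  by rewrite (nth_map j) ?sj //= outcome_pair nth_ord_enum.
have Vh01 : V (h0 ++ h1) = join (f x) (f y).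
  by rewrite -Vh; apply/ffunP => j; rewrite !ffunE nth_cat s0 ltn_ord.
have [sU /(_ x y xy erefl)[xU yU]] := hU (join (f x) (f y)).
have h1E : h1 = [seq z \in S' | z <- enum (U (join (f x) (f y)))].
  by rewrite /h1 Vh -map_comp; apply: eq_map => z /=; rewrite outcome_set1.
split; last by rewrite size_cat s0 leq_add2l h1E size_map -cardE.
rewrite Vh01 drop_size_cat // h1E -filter_mask.
apply/setP => z; rewrite inE mem_filter mem_enum.
case: (boolP (z \in S')) => //=; rewrite /S' !inE => /orP[] /eqP -> //.
Qed.

(** * Counting lower bound *)

(** Defective sets map injectively to histories of length at most [n], of which there are fewer than
    [2 ^ n.+1]. *)
Lemma feasible_leq_exp (p t s n : nat) : feasible p t s n -> ('C(t, s) <= 2 ^ n.+1)%N.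
Proof.
case=> A [dec hA]; rewrite -[t in 'C(t, _)]card_ord -card_draws.
(* Histories have varying lengths: the appended [true] marks the end before padding. *)
pose enc (h : seq bool) : word n.+1 := [ffun i : 'I_n.+1 => nth false (rcons h true) i].
have nth_last h : nth false (rcons h true) (size h) = true.
  by rewrite nth_rcons ltnn eqxx.
have enc_size h h' : (size h' <= n)%N -> enc h = enc h' -> (size h' <= size h)%N.
  move=> sh e; rewrite leqNgt; apply/negP => lt.
  have hn : (size h' < n.+1)%N by [].
  have := congr1 (fun w : word n.+1 => w (Ordinal hn)) e.
  by rewrite !ffunE /= nth_last nth_default ?size_rcons.
have enc_inj h h' : (size h <= n)%N -> (size h' <= n)%N -> enc h = enc h' -> h = h'.
  move=> sh sh' e; have sE : size h = size h' by apply/eqP; rewrite eqn_leq !enc_size.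
  apply: (@eq_from_nth _ false) => // i ih.
  have hn : (i < n.+1)%N by lia.
  have := congr1 (fun w : word n.+1 => w (Ordinal hn)) e.
  by rewrite !ffunE /= !nth_rcons -sE ih.
have -> : (2 ^ n.+1 = #|{: word n.+1}|)%N by rewrite card_ffun card_bool card_ord.
apply: (@leq_card_in _ _ (fun S => enc (run A S p))) => S T; rewrite !inE => /eqP sS /eqP sT.
have [dS nS] := hA S sS; have [dT nT] := hA T sT.
by move=> /(enc_inj _ _ nS nT) E; rewrite -dS -dT E.
Qed.

Lemma N_spec (p t s n : nat) : feasible p t s n ->
  feasible p t s (N p t s) /\ (N p t s <= n)%N.
Proof.
rewrite /N => hn; case: pselect => [h|]; last by case; exists n.
by case: ex_minnP => m /asboolP hm min; split => //; apply/min/asboolP.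
Qed.

(** * Explicit number of tests for large [t] *)

(** Absorbs the polynomial factors: with [b = a %/ 4], [c * a.+1 <= b * b.+1 < 2 ^ (2 * b)]. *)
Lemma sqr_lt_exp2 (c a : nat) : (16 * c <= a)%N -> ((c * a.+1) ^ 2 < 2 ^ a)%N.
Proof.
move=> ca; set b := (a %/ 4)%N.
have cb : (4 * c <= b)%N by rewrite leq_divRL //; lia.
have ab : (a.+1 <= 4 * b.+1)%N by rewrite /b; lia.
have b2 : (b < 2 ^ b)%N by apply: ltn_expl.
have : (2 ^ (b * 4) <= 2 ^ a)%N by rewrite leq_exp2l // leq_divM.
apply: leq_trans; rewrite (_ : b * 4 = (b + b) * 2)%N; last by lia.
rewrite expnM ltn_exp2r // expnD.
apply: (@leq_ltn_trans (b * b.+1)); last first.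
  by rewrite (@leq_ltn_trans (b * 2 ^ b)) ?leq_mul2l ?b2 ?orbT // ltn_pmul2r ?expn_gt0.
apply: (@leq_trans (c * (4 * b.+1))); first by rewrite leq_mul2l ab orbT.
by rewrite mulnCA mulnA leq_mul2r cb orbT.
Qed.

(** The bound [(2 + 2 / k) log2 t + 10 (k + 1)], multiplied by [k] to stay in [nat]. Of the constant
    10, 8 pays for stage 2 and 2 for rounding [a] up. *)
Lemma feasible_two_defectives (R : rcfType) (k : nat) : (0 < k)%N -> exists t0, forall t,
  (t0 <= t)%N ->
  exists2 n, feasible 3 t 2 n & (k * n <= 2 * k.+1 * up_log 2 t + 10 * (k * k.+1))%N.
Proof.
move=> k0; pose c := ((8 * k.+1).+1 * (2 * k.+1).+1)%N.
(* The threshold forces [16 * c <= a], where [c * a.+1] bounds the polynomial factor in [hK]. *)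
exists (2 ^ (k * (16 * c)))%N => t ht; pose a := (up_log 2 t %/ k).+1.
have ka : (up_log 2 t < k * a)%N by rewrite mulnC ltn_ceil.
have ak : (k * a <= up_log 2 t + k)%N by rewrite /a mulnS addnC leq_add2r mulnC leq_divM.
have ca : (16 * c <= a)%N.
  have := leq_up_log 2 ht; rewrite up_expnK // => /leq_ltn_trans/(_ ka).
  by rewrite ltn_mul2l k0 => /ltnW.
have tk : (t <= 2 ^ (k * a))%N.
  by apply: leq_trans (up_logP t (isT : 1 < 2)%N) _; rewrite leq_exp2l // ltnW.
have hK : (((2 * (4 * k.+1)).+1 * (2 * (k.+1 * a)).+1) ^ 2 < 2 ^ a)%N.
  apply: leq_ltn_trans (sqr_lt_exp2 ca); rewrite leq_exp2r // /c -mulnA.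
  by apply: leq_mul; lia.
have [f hf] := exists_good_code R tk hK.
exists (2 * (k.+1 * a) + 2 * (4 * k.+1))%N; first exact: feasible_of_code hf.
rewrite (_ : k * _ = 2 * k.+1 * (k * a) + 8 * (k * k.+1))%N; last by lia.
apply: leq_trans (leq_add (leq_mul (leqnn _) ak) (leqnn _)) _; lia.
Qed.

(** * Passage to the limit *)

Local Notation lg R t := (ln (t%:R : R) / ln (2 : R)).

Lemma ln2_gt0 (R : realType) : 0 < ln (2 : R).
Proof. by rewrite ln_gt0 // ltr1n. Qed.

Lemma exp2_le_lg (R : realType) (m t : nat) : (2 ^ m <= t)%N -> m%:R <= lg R t.
Proof.
move=> mt; rewrite ler_pdivlMr ?ln2_gt0 // mulr_natl -lnXn // -natrX.
by rewrite ler_ln ?posrE ?ltr0n ?expn_gt0 ?ler_nat // (leq_trans _ mt) ?expn_gt0.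
Qed.

Lemma up_log_le_lg (R : realType) (t : nat) : (1 < t)%N -> (up_log 2 t)%:R <= lg R t + 1.
Proof.
move=> t1; have := up_log_gtn (isT : 1 < 2)%N t1 => /ltnW/(@exp2_le_lg R) h.
rewrite -lerBlDr; apply: le_trans h.
by rewrite lerBlDr -[1]/(1%:R) -natrD ler_nat addn1 leqSpred.
Qed.

Lemma lg_le_feasible (R : realType) (p t n : nat) :
  (1 < t)%N -> feasible p t 2 n -> 2 * lg R t <= n%:R + 3.
Proof.
move=> t1 /feasible_leq_exp; rewrite bin2 => h.
(* For [t >= 2], [t ^ 2] is at most four times the number of pairs. *)
have {}h : (t ^ 2 <= 2 ^ (n + 3))%N.
  have := odd_double_half (t * t.-1); rewrite !expnD !expnS !expn0 in h *; nia.
rewrite mulrA ler_pdivrMr ?ln2_gt0 // -[3]/(3%:R) -natrD mulr_natl [leRHS]mulr_natl.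
rewrite -!lnXn ?ltr0n // ?(ltnW t1) // -!natrX ler_ln ?posrE ?ltr0n ?expn_gt0 ?ler_nat //.
by rewrite (ltnW t1).
Qed.

Local Open Scope classical_set_scope.

Lemma cvg_N_3_2 (R : realType) : ((N 3 t 2)%:R / lg R t : R) @[t --> \oo] --> (2 : R).
Proof.
apply/cvgrPdist_le => e e0.
(* Makes the excess [2 / k] of the slope at most [e / 2]. *)
pose k := (Num.bound (4 / e)).+1.
have ke : 4 / e <= k%:R.
  by apply/ltW/(lt_le_trans (archi_boundP _)); rewrite ?ler_nat // divr_ge0 // ltW.
have [t0 ht0] := @feasible_two_defectives R k isT.
(* The additive terms of [hi] are at most [12 * k * (k + 1)]; a logarithm of at least [m] keeps them
   within the other [e / 2]. *)
pose m := (Num.bound (24 * k.+1%:R / e)).+1.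
have me : 24 * k.+1%:R / e <= m%:R.
  by apply/ltW/(lt_le_trans (archi_boundP _)); rewrite ?ler_nat // divr_ge0 ?mulr_ge0 // ltW.
near=> t.
have [n fn hn] : exists2 n, feasible 3 t 2 n &
    (k * n <= 2 * k.+1 * up_log 2 t + 10 * (k * k.+1))%N.
  by apply: ht0; near: t; exists t0.
have mt : m%:R <= lg R t by apply: exp2_le_lg; near: t; exists (2 ^ m)%N.
have t1 : (1 < t)%N by near: t; exists 2%N.
have [fN Nn] := N_spec fn.
have lo := @lg_le_feasible R _ _ _ t1 fN.
have hi : k%:R * (N 3 t 2)%:R <= 2 * k.+1%:R * (lg R t + 1) + 10 * (k%:R * k.+1%:R).
  have : (k * N 3 t 2 <= 2 * k.+1 * up_log 2 t + 10 * (k * k.+1))%N.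
    by apply: leq_trans hn; rewrite leq_mul2l Nn orbT.
  rewrite -(ler_nat R) natrD !natrM => /le_trans; apply.
  by rewrite lerD2r ler_wpM2l ?mulr_ge0 // up_log_le_lg.
set l := lg R t in mt lo hi *; set x := (N 3 t 2)%:R in lo hi *.
have k1 : 1 <= k%:R :> R by rewrite ler1n.
have m1 : 1 <= m%:R :> R by rewrite ler1n.
have l0 : 0 < l by apply: lt_le_trans mt; lra.
rewrite ler_pdivrMr // in ke.
rewrite ler_pdivrMr // in me.
have le : 24 * k.+1%:R <= l * e by apply: le_trans me _; rewrite ler_wpM2r // ltW.
rewrite -natr1 in hi le.
set K : R := k%:R in k1 ke hi le.
rewrite distrC ler_norml; apply/andP; split.
  rewrite lerBrDr ler_pdivlMr //; nra.
rewrite lerBlDr ler_pdivrMr //.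
rewrite -(ler_pM2l (_ : 0 < K)); last by lra.
apply: le_trans hi _.
have h1 : 4 * l <= K * e * l by rewrite ler_wpM2r // ltW.
have h2 : K * (24 * (K + 1)) <= K * (l * e) by rewrite ler_wpM2l //; lra.
have h3 : K + 1 <= K * (K+1) by rewrite ler_peMl //; lra.
nra.
Unshelve. all: by end_near.
Qed.

Theorem theorem1 (R : realType) : C (R := R) 3 2 = (2%:R : R)%:E.
Proof.
have /cvg_limn_einf_sup[_] : ((((N 3 t 2)%:R : R) / (ln (t%:R : R) / ln (2 : R)))%:E
    @[t --> \oo] --> (2%:R : R)%:E)%classic.
  by apply: cvg_EFin; [exact: nearW | exact: cvg_N_3_2].
by [].
Qed.
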